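(* Let $R$ be a valuation ring, let $Z$ be the ideal of its zero-divisors and let $Q=R_Z$ be its total quotient ring. The following conditions are equivalent: (1) $Z$ is nilpotent; (2) $Q$ is an artinian ring; (3) each flat $R$-module is finitely projective; (4) each flat $R$-module is singly projective.
   Context: A valuation ring is a commutative ring $R$ (possibly with zero-divisors) whose set of ideals is totally ordered by inclusion. $Z=\{s\in R\mid \exists\, 0\ne x\in R,\ sx=0\}$ is a prime ideal of $R$. An $R$-module $M$ is finitely projective (respectively singly projective) if, for any finitely generated (respectively cyclic) submodule $N$ of $M$, the inclusion map $N\to M$ factors through a free module. *)

(* Defs.v *)
From HB Require Import structures.
From mathcomp Require Import all_boot all_algebra.
From mathcomp Require Import boolp classical_sets cardinality.
From mathcomp Require Import freeg ring.

Set Implicit Arguments.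
Unset Strict Implicit.
Unset Printing Implicit Defensive.

Import GRing.Theory.
Local Open Scope classical_set_scope.
Local Open Scope ring_scope.
Local Open Scope quotient_scope.

Definition submodule (R : pzRingType) (V : lmodType R) (S : set V) : Prop :=
  GRing.submod_closed [in S].

Definition generated (R : pzRingType) (V : lmodType R) (G : set V) : set V :=
  smallest (@submodule R V) G.

Definition ideal (A : comPzRingType) (I : set A) : Prop :=
  @submodule A A^o I.

Definition ideal_mul (A : comPzRingType) (I J : set A) : set A :=
  smallest (@ideal A) [set x * y | x in I & y in J].

Fixpoint ideal_exp (A : comPzRingType) (I : set A) (n : nat) : set A :=
  if n is m.+1 then ideal_mul I (ideal_exp I m) else [set: A].

Definition nilpotent_ideal (A : comPzRingType) (I : set A) : Prop :=
  exists n, ideal_exp I n = [set 0].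

Definition artinian (A : comPzRingType) : Prop :=
  forall I : nat -> set A,
    (forall n, ideal (I n)) -> (forall n, I n.+1 `<=` I n) ->
    exists N, forall n, (N <= n)%N -> I n = I N.

Definition valuation_ring (R : comNzRingType) : Prop :=
  forall I J : set R, ideal I -> ideal J -> I `<=` J \/ J `<=` I.

Definition zero_divisors (R : comNzRingType) : set R :=
  [set s | exists2 x, x != 0 & s * x = 0].
Arguments zero_divisors R _ : clear implicits.

Module Localization.
Section Construction.
Variables (R : comPzRingType) (S : mulrClosed R).

Record fraction := Fraction { pair_of :> R * R; _ : pair_of.2 \in S }.

HB.instance Definition _ := [isSub for pair_of].
HB.instance Definition _ := [Choice of fraction by <:].

Implicit Types x y z : fraction.

Lemma denP x : x.2 \in S. Proof. by case: x. Qed.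

Definition equiv x y : bool :=
  `[< exists2 u, u \in S & u * (x.1 * y.2) = u * (y.1 * x.2) >].

Lemma equiv_refl : reflexive equiv.
Proof. by move=> x; apply/asboolP; exists 1; rewrite ?rpred1. Qed.

Lemma equiv_sym : symmetric equiv.
Proof. by move=> x y; apply/asboolP/asboolP => -[u uS e]; exists u. Qed.

Lemma equiv_trans : transitive equiv.
Proof.
move=> y x z /asboolP[u uS e] /asboolP[v vS e']; apply/asboolP.
exists (u * v * y.2); first by rewrite !rpredM ?denP.
have -> : u * v * y.2 * (x.1 * z.2) = v * z.2 * (u * (x.1 * y.2)) by ring.
rewrite e.
have -> : v * z.2 * (u * (y.1 * x.2)) = u * x.2 * (v * (y.1 * z.2)) by ring.
rewrite e'; ring.
Qed.

Canonical equiv_equiv := EquivRel equiv equiv_refl equiv_sym equiv_trans.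

Definition type := {eq_quot equiv}.

HB.instance Definition _ : EqQuotient _ equiv type := EqQuotient.on type.
HB.instance Definition _ := Choice.on type.

Definition frac1 (a : R) : fraction := @Fraction (a, 1) (rpred1 S).
Definition addf x y : fraction :=
  @Fraction (x.1 * y.2 + y.1 * x.2, x.2 * y.2) (rpredM (denP x) (denP y)).
Definition oppf x : fraction := @Fraction (- x.1, x.2) (denP x).
Definition mulf x y : fraction :=
  @Fraction (x.1 * y.1, x.2 * y.2) (rpredM (denP x) (denP y)).

Lemma equiv_repr x : equiv (repr (\pi_type x)) x.
Proof. by have /eqmodP := reprK (\pi_type x). Qed.

Definition of_base := lift_embed type frac1.
Canonical of_base_pi_morph := PiEmbed of_base.

Definition add := lift_op2 type addf.
Lemma pi_add : {morph \pi : x y / addf x y >-> add x y}.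
Proof.
move=> x y; unlock add; apply/eqmodP; rewrite /= equiv_sym.
have /asboolP[u uS e] := equiv_repr x; have /asboolP[v vS e'] := equiv_repr y.
move: (repr _) (repr _) e e' => y' x' e e'.
apply/asboolP; exists (u * v); rewrite ?rpredM //=.
transitivity (v * y'.2 * y.2 * (u * (x'.1 * x.2)) +
              u * x'.2 * x.2 * (v * (y'.1 * y.2))); first by ring.
rewrite e e'; ring.
Qed.
Canonical pi_add_morph := PiMorph2 pi_add.

Definition opp := lift_op1 type oppf.
Lemma pi_opp : {morph \pi : x / oppf x >-> opp x}.
Proof.
move=> x; unlock opp; apply/eqmodP; rewrite /= equiv_sym.
have /asboolP[u uS e] := equiv_repr x.
by apply/asboolP; exists u; rewrite //= !mulNr !mulrN e.
Qed.
Canonical pi_opp_morph := PiMorph1 pi_opp.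

Definition mul := lift_op2 type mulf.
Lemma pi_mul : {morph \pi : x y / mulf x y >-> mul x y}.
Proof.
move=> x y; unlock mul; apply/eqmodP; rewrite /= equiv_sym.
have /asboolP[u uS e] := equiv_repr x; have /asboolP[v vS e'] := equiv_repr y.
move: (repr _) (repr _) e e' => y' x' e e'.
apply/asboolP; exists (u * v); rewrite ?rpredM //=.
transitivity ((u * (x'.1 * x.2)) * (v * (y'.1 * y.2))); first by ring.
rewrite e e'; ring.
Qed.
Canonical pi_mul_morph := PiMorph2 pi_mul.

Local Lemma eq_frac x y : x.1 * y.2 = y.1 * x.2 -> \pi_type x = \pi_type y.
Proof.
by move=> e; apply/eqmodP/asboolP; exists 1; rewrite ?rpred1 ?e.
Qed.

Lemma addA : associative add.
Proof.
elim/quotW=> x; elim/quotW=> y; elim/quotW=> z; rewrite !piE.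
apply: eq_frac => /=; ring.
Qed.

Lemma addC : commutative add.
Proof.
elim/quotW=> x; elim/quotW=> y; rewrite !piE; apply: eq_frac => /=; ring.
Qed.

Lemma add0 : left_id (of_base 0) add.
Proof. elim/quotW=> x; rewrite !piE; apply: eq_frac => /=; ring. Qed.

Lemma addN : left_inverse (of_base 0) opp add.
Proof. elim/quotW=> x; rewrite !piE; apply: eq_frac => /=; ring. Qed.

HB.instance Definition _ := GRing.isZmodule.Build type addA addC add0 addN.

Lemma mulA : associative mul.
Proof.
elim/quotW=> x; elim/quotW=> y; elim/quotW=> z; rewrite !piE.
apply: eq_frac => /=; ring.
Qed.

Lemma mulC : commutative mul.
Proof.
elim/quotW=> x; elim/quotW=> y; rewrite !piE; apply: eq_frac => /=; ring.
Qed.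

Lemma mul1 : left_id (of_base 1) mul.
Proof. elim/quotW=> x; rewrite !piE; apply: eq_frac => /=; ring. Qed.

Lemma mul_addl : left_distributive mul add.
Proof.
elim/quotW=> x; elim/quotW=> y; elim/quotW=> z; rewrite !piE.
apply: eq_frac => /=; ring.
Qed.

HB.instance Definition _ :=
  GRing.Zmodule_isComPzRing.Build type mulA mulC mul1 mul_addl.

Lemma of_base_is_zmod_morphism : zmod_morphism of_base.
Proof.
move=> a b; rewrite -[RHS]/(add _ (opp _)) !piE; apply: eq_frac => /=; ring.
Qed.

Lemma of_base_is_monoid_morphism : monoid_morphism of_base.
Proof.
split=> // a b; rewrite -[RHS]/(mul _ _) !piE.
apply: eq_frac => /=; ring.
Qed.

HB.instance Definition _ :=
  GRing.isZmodMorphism.Build R type of_base of_base_is_zmod_morphism.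
HB.instance Definition _ :=
  GRing.isMonoidMorphism.Build R type of_base of_base_is_monoid_morphism.

(* The three properties characterising the localization up to isomorphism. *)
Lemma of_base_inv s : s \in S -> exists t : type, of_base s * t = 1.
Proof.
move=> sS; exists (\pi_type (@Fraction (1, s) sS)).
rewrite -[LHS]/(mul _ _) -[RHS]/(of_base 1) !piE; apply: eq_frac => /=; ring.
Qed.

Lemma of_base_eq a b :
  of_base a = of_base b <-> exists2 u, u \in S & u * a = u * b.
Proof.
split.
  rewrite !piE => /eqmodP/asboolP[u uS] /=.
  by rewrite !mulr1 => e; exists u.
move=> [u uS e]; rewrite !piE; apply/eqmodP/asboolP; exists u => //=.
by rewrite !mulr1.
Qed.

Lemma of_base_div (q : type) :
  exists a s, s \in S /\ of_base s * q = of_base a.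
Proof.
elim/quotW: q => x; exists x.1, x.2; split; first exact: denP.
rewrite -[LHS]/(mul _ _) !piE; apply: eq_frac => /=; ring.
Qed.

End Construction.
End Localization.
HB.export Localization.

Definition localization (R : comPzRingType) (S : mulrClosed R) : comPzRingType :=
  Localization.type S.

Section TotalQuotientRing.
Variable R : comNzRingType.

Definition nonzero_divisor : {pred R} := [pred s | s \notin zero_divisors R].

Lemma nonzero_divisorP s :
  reflect (forall x, s * x = 0 -> x = 0) (s \in nonzero_divisor).
Proof.
rewrite inE; apply: (iffP negP) => [sZ x sx0|sreg].
  by apply: contrapT => /eqP x0; apply: sZ; rewrite inE; exists x.
by rewrite inE => -[x /eqP x0 /sreg].
Qed.

Lemma nonzero_divisor_mulr_closed : mulr_closed nonzero_divisor.
Proof.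
split=> [|s t /nonzero_divisorP sreg /nonzero_divisorP treg].
  by apply/nonzero_divisorP => x; rewrite mul1r.
by apply/nonzero_divisorP => x; rewrite -mulrA => /sreg/treg.
Qed.

HB.instance Definition _ :=
  GRing.isMulClosed.Build R nonzero_divisor nonzero_divisor_mulr_closed.

(* The localization at the complement of [zero_divisors R], i.e. R_Z when the
   zero divisors form a prime ideal Z. *)
Definition total_quotient_ring : comPzRingType := localization nonzero_divisor.

End TotalQuotientRing.

Module QuotientModule.
Section Construction.
Variables (R : pzRingType) (V : lmodType R) (K : set V) (subK : submodule K).

Definition kernel of submodule K : {pred V} := [in K].

HB.instance Definition _ :=
  GRing.isSubmodClosed.Build R V (kernel subK)
  (GRing.submod_closed_semi subK).

Definition type := Quotient.quot (kernel subK).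

HB.instance Definition _ := GRing.Zmodule.on type.
HB.instance Definition _ := EqQuotient.on type.

Definition scale (a : R) (q : type) : type := \pi_type (a *: repr q).

Lemma pi_scale a v : scale a (\pi_type v) = \pi_type (a *: v).
Proof.
apply/eqP; rewrite eqmodE /= Quotient.equivE -scalerBr rpredZ //.
by rewrite Quotient.idealrBE reprK.
Qed.

Lemma scaleA a b q : scale a (scale b q) = scale (a * b) q.
Proof. by elim/quotW: q => v; rewrite [scale b _]pi_scale !pi_scale scalerA. Qed.

Lemma scale1 : left_id 1 scale.
Proof. by elim/quotW=> v; rewrite pi_scale scale1r. Qed.

Lemma piD u v : \pi_type (u + v) = \pi_type u + \pi_type v.
Proof. exact: (Quotient.pi_add (kernel subK) u v). Qed.

Lemma scaleDr : right_distributive scale +%R.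
Proof.
move=> a; elim/quotW=> u; elim/quotW=> v.
by rewrite !pi_scale -!piD pi_scale scalerDr.
Qed.

Lemma scaleDl q : {morph scale^~ q : a b / a + b}.
Proof. by elim/quotW: q => v a b; rewrite !pi_scale -piD scalerDl. Qed.

HB.instance Definition _ := GRing.Zmodule_isLmodule.Build R type
  scaleA scale1 scaleDr scaleDl.

Definition proj (v : V) : type := \pi_type v.

Lemma proj_is_linear : linear proj.
Proof. by move=> a u v; rewrite /proj piD -pi_scale. Qed.

HB.instance Definition _ := GRing.isLinear.Build R V type _ proj proj_is_linear.

Lemma proj_eq0 v : (proj v == 0) = (v \in K).
Proof. by rewrite -(raddf0 proj) /proj eqmodE /= Quotient.equivE subr0. Qed.

End Construction.
End QuotientModule.
HB.export QuotientModule.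

Lemma generated_submodule (R : pzRingType) (V : lmodType R) (G : set V) :
  submodule (generated G).
Proof.
split=> [|a u v]; first by rewrite inE => K [[+ _] _]; rewrite inE.
rewrite !inE => Gu Gv K /[dup] KG [[_ lin] _]; rewrite -[K _]inE.
by apply: lin; rewrite inE; [exact: Gu KG|exact: Gv KG].
Qed.

Section Tensor.
Variables (R : comNzRingType) (M N : lmodType R).
Local Notation F := {freeg (M * N)%type / R}.
Local Notation "[: m , n :]" := (<< (m, n) >> : F).

Variant tensor_relator : set F :=
| TensorDl m m' n : tensor_relator ([: m + m', n :] - ([: m, n :] + [: m', n :]))
| TensorDr m n n' : tensor_relator ([: m, n + n' :] - ([: m, n :] + [: m, n' :]))
| TensorZl a m n : tensor_relator ([: a *: m, n :] - a *: [: m, n :])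
| TensorZr a m n : tensor_relator ([: m, a *: n :] - a *: [: m, n :]).

Definition tensor : lmodType R :=
  QuotientModule.type (generated_submodule tensor_relator).

Definition pure_tensor (m : M) (n : N) : tensor :=
  QuotientModule.proj (generated_submodule tensor_relator) [: m, n :].

(* The map induced by [b]; it is only meaningful when [b] is bilinear, see
   [tensor_lift_pure] and [tensor_lift_is_linear]. *)
Definition tensor_lift (P : lmodType R) (b : M -> N -> P) (t : tensor) : P :=
  fglift (fun p => b p.1 p.2) (repr t).

Lemma pure_tensor_is_bilinear :
  bilinear_for *:%R *:%R (pure_tensor : M -> N -> tensor).
Proof.
have eq_proj (D E : F) : tensor_relator (D - E) ->
    QuotientModule.proj (generated_submodule tensor_relator) D =
    QuotientModule.proj (generated_submodule tensor_relator) E.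
  move=> DE; apply/eqP; rewrite -subr_eq0 -raddfB QuotientModule.proj_eq0 inE.
  by move=> K [_]; apply.
have ptD m m' n : pure_tensor (m + m') n = pure_tensor m n + pure_tensor m' n.
  by rewrite -raddfD; apply: eq_proj; constructor.
have ptZ a m n : pure_tensor (a *: m) n = a *: pure_tensor m n.
  by rewrite -linearZ; apply: eq_proj; constructor.
have ptDr m n n' : pure_tensor m (n + n') = pure_tensor m n + pure_tensor m n'.
  by rewrite -raddfD; apply: eq_proj; constructor.
have ptZr a m n : pure_tensor m (a *: n) = a *: pure_tensor m n.
  by rewrite -linearZ; apply: eq_proj; constructor.
split=> [n a m m'|m a n n'] /=; first by rewrite ptD ptZ.
by rewrite ptDr ptZr.
Qed.

Section Lift.
Variables (P : lmodType R) (b : M -> N -> P).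
Hypothesis bilin_b : bilinear_for *:%R *:%R b.
Let h (p : (M * N)%type) := b p.1 p.2.
Let lift_h : F -> P := fglift h.

HB.instance Definition _ :=
  GRing.isZmodMorphism.Build F P lift_h (lift_is_additive h).

Let lift_hU k p : lift_h << k *g p >> = k *: h p.
Proof. exact: liftU. Qed.


Let fgliftZ a (D : F) : lift_h (a *: D) = a *: lift_h D.
Proof.
have fgZU k z : a *: (<< k *g z >> : F) = << a * k *g z >>.
  by apply/eqP/freeg_eqP => x; rewrite coeffZ !coeffU mulrA.
rewrite -[D in LHS]freeg_sumE -[D in RHS]freeg_sumE scaler_sumr.
have sumE (r : seq (M * N)) (c : M * N -> R) :
    lift_h (\sum_(z <- r) << c z *g z >>) = \sum_(z <- r) c z *: h z.
  by rewrite (raddf_sum lift_h); apply: eq_bigr => z _; exact: lift_hU.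
under eq_bigr do rewrite fgZU.
by rewrite !sumE scaler_sumr; apply: eq_bigr => z _; rewrite scalerA.
Qed.

Let lift_proj (D : F) :
  tensor_lift b (QuotientModule.proj (generated_submodule tensor_relator) D)
  = lift_h D.
Proof.
set q := QuotientModule.proj _ D.
have fgB (D1 D2 : F) : lift_h (D1 - D2) = lift_h D1 - lift_h D2.
  exact: (raddfB lift_h).
have fgD (D1 D2 : F) : lift_h (D1 + D2) = lift_h D1 + lift_h D2.
  exact: (raddfD lift_h).
have bZl a m n : b (a *: m) n = a *: b m n.
  by have := scalable_linear (bilin_b.1 n) a m.
have bZr a m n : b m (a *: n) = a *: b m n.
  by have := scalable_linear (bilin_b.2 m) a n.
have bDl m m' n : b (m + m') n = b m n + b m' n.
  by have := bilin_b.1 n 1 m m'; rewrite /= !scale1r => ->; congr (_ + _); exact: scale1r.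
have bDr m n n' : b m (n + n') = b m n + b m n'.
  by have := bilin_b.2 m 1 n n'; rewrite /= !scale1r => ->; congr (_ + _); exact: scale1r.
have : repr q - D \in generated tensor_relator.
  rewrite -(QuotientModule.proj_eq0 (generated_submodule tensor_relator)).
  by rewrite raddfB /= subr_eq0; apply/eqP; rewrite /QuotientModule.proj reprK.
rewrite inE => /(_ [set E | lift_h E = 0]) qD.
suff /qD : [set K | submodule K /\ tensor_relator `<=` K] [set E | lift_h E = 0].
  by rewrite /= fgB => /subr0_eq.
split.
  split=> [|a u v]; first by rewrite inE; exact: (raddf0 lift_h).
  by rewrite !inE /= => u0 v0; rewrite fgD fgliftZ u0 v0 scaler0 addr0.
by move=> E [m m' n|m n n'|a m n|a m n] /=;
  rewrite fgB ?fgD ?fgliftZ !lift_hU !scale1r /h /= ?(bDl, bDr, bZl, bZr) subrr.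
Qed.

Lemma tensor_lift_pure m n : tensor_lift b (pure_tensor m n) = b m n.
Proof. by rewrite lift_proj lift_hU scale1r. Qed.

Lemma tensor_lift_is_linear : linear (tensor_lift b).
Proof.
move=> a; elim/quotW=> u; elim/quotW=> v.
have := lift_proj (a *: u + v); rewrite linearP /= => ->.
have -> : lift_h (a *: u + v) = a *: lift_h u + lift_h v.
  by rewrite -fgliftZ; exact: (raddfD lift_h).
by rewrite -!lift_proj.
Qed.

End Lift.
End Tensor.

Section TensorMap.
Variables (R : comNzRingType) (M A B : lmodType R) (f : {linear A -> B}).

(* id_M (x) f *)
Definition tensor_map : tensor M A -> tensor M B :=
  tensor_lift (fun m a => pure_tensor m (f a)).

Let bilin : bilinear_for *:%R *:%R (fun (m : M) a => pure_tensor m (f a)).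
Proof.
have [linl linr] := pure_tensor_is_bilinear M B.
by split=> [a c m m'|m c a a'] /=; [exact: linl|rewrite linearP; exact: linr].
Qed.

Lemma tensor_map_pure m a :
  tensor_map (pure_tensor m a) = pure_tensor m (f a).
Proof. exact: tensor_lift_pure. Qed.

Lemma tensor_map_is_linear : linear tensor_map.
Proof. exact: tensor_lift_is_linear. Qed.

End TensorMap.
Arguments tensor_map {R} M {A B} f _.

Section Modules.
Variable R : comNzRingType.

Definition flat (M : lmodType R) : Prop :=
  forall (A B : lmodType R) (f : {linear A -> B}),
    injective f -> injective (tensor_map M f).

Definition free_module (F : lmodType R) : Prop :=
  exists (I : choiceType) (h : {linear {freeg I / R} -> F}), bijective h.

Definition finitely_generated (N : lmodType R) : Prop :=
  exists2 G : set N, finite_set G & generated G = [set: N].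

Definition cyclic_module (N : lmodType R) : Prop :=
  exists x : N, generated [set x] = [set: N].

Definition factors_through_free (N M : lmodType R) (f : {linear N -> M}) : Prop :=
  exists (F : lmodType R) (u : {linear N -> F}) (v : {linear F -> M}),
    free_module F /\ f =1 v \o u.

Definition finitely_projective (M : lmodType R) : Prop :=
  forall (S : {pred M}) (N : subLmodType S),
    finitely_generated N -> factors_through_free (\val : {linear N -> M}).

Definition singly_projective (M : lmodType R) : Prop :=
  forall (S : {pred M}) (N : subLmodType S),
    cyclic_module N -> factors_through_free (\val : {linear N -> M}).

End Modules.

(* Main.v *)
(** Call an element regular when it is not a zero divisor.  All four conditions
    are equivalent to the T-nilpotence of Z: every sequence a_0, a_1, ... in Z
    has a vanishing product a_0 ... a_(k-1).  If Z is T-nilpotent, either every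
    element of Z is a product of two elements of Z, and then Z = 0, or some p in
    Z is no such product; p is then nilpotent and every element of Z is, up to
    a regular factor, a multiple of p.  Hence every element of R is, up to
    regular factors, a power of p, which makes Z nilpotent and Q artinian.
    Moreover the ideals of R are principal up to regular factors, so
    finitely many relations generate, up to regular factors, all relations
    between given elements of a flat module; flatness kills these one at a time.

    Conversely, the direct limit of R --a_0--> R --a_1--> ... is flat.  If the
    submodule generated by the class x of 1 factors through a free module, then
    x = c m with ann c = ann x, which forces the annihilators of the products
    a_0 ... a_(k-1) to stabilize; for a_i in Z this happens only at 0. *)
From HB Require Import structures.
Require Import Defs.
From mathcomp Require Import all_boot all_algebra.
From mathcomp Require Import boolp classical_sets functions cardinality.
From mathcomp Require Import freeg ring.

Set Implicit Arguments.
Unset Strict Implicit.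
Unset Printing Implicit Defensive.

Import GRing.Theory.
Local Open Scope classical_set_scope.
Local Open Scope ring_scope.
Local Open Scope quotient_scope.

(** * Submodules and linear maps in elementary form *)

Lemma submoduleP (R : pzRingType) (V : lmodType R) (S : set V) :
  submodule S <-> S 0 /\ forall a u v, S u -> S v -> S (a *: u + v).
Proof.
split=> [[S0 SL]|[S0 SL]].
  split=> [|a u v Su Sv]; first by move: S0; rewrite inE.
  by have := SL a u v; rewrite !inE; apply.
by split=> [|a u v]; rewrite !inE //; exact: SL.
Qed.

Lemma submodule_scale (R : pzRingType) (V : lmodType R) (S : set V) a v :
  submodule S -> S v -> S (a *: v).
Proof. by move=> /submoduleP[S0 SL] Sv; rewrite -[_ *: _]addr0; exact: SL. Qed.

Lemma sub_generated (R : pzRingType) (V : lmodType R) (G : set V) :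
  G `<=` generated G.
Proof. exact: sub_gen_smallest. Qed.

Lemma linear_fun0 (R : pzRingType) (U V : lmodType R) (f : U -> V) :
  linear f -> f 0 = 0.
Proof. by move=> /(_ (-1) 0 0); rewrite scaler0 addr0 scaleN1r addNr. Qed.

(** * Divisibility, zero divisors and T-nilpotence in a valuation ring *)

Section ValuationRing.
Variable R : comNzRingType.
Hypothesis val_R : valuation_ring R.
Local Notation Z := (zero_divisors R).
Local Notation regular := (@nonzero_divisor R).

Lemma regular1 : 1 \in regular.
Proof. by apply/nonzero_divisorP => x; rewrite mul1r. Qed.

Lemma regularM s t : s \in regular -> t \in regular -> s * t \in regular.
Proof. by move=> sr tr; exact: (nonzero_divisor_mulr_closed R).2. Qed.

Lemma regular_mul0 s x : s \in regular -> s * x = 0 -> x = 0.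
Proof. by move=> /nonzero_divisorP; apply. Qed.

Lemma regularPn s : (s \notin regular) <-> Z s.
Proof. by rewrite inE negbK inE. Qed.

Lemma valuation_dvd (a b : R) : exists d, a = d * b \/ b = d * a.
Proof.
pose I (x : R) : set R := [set y | exists r, y = r * x].
have idI x : ideal (I x).
  apply/submoduleP; split=> [|r _ _ [u ->] [v ->]]; first by exists 0; rewrite mul0r.
  by exists (r * u + v); rewrite mulrDl -mulrA.
have Ix x : I x x by exists 1; rewrite mul1r.
by case: (val_R (idI a) (idI b)) => [/(_ _ (Ix a))|/(_ _ (Ix b))] [d ->];
  exists d; [left|right].
Qed.

Lemma valuation_dvd_family (I : eqType) (c : I -> R) (s : seq I) :
  s != [::] -> exists2 i, i \in s & forall j, j \in s -> exists d, c j = d * c i.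
Proof.
elim: s => // i [|j s] IH _.
  by exists i => [|k]; rewrite ?mem_seq1 // => /eqP->; exists 1; rewrite mul1r.
have [k ks kdvd] := IH isT; have [d [e|e]] := valuation_dvd (c i) (c k).
  exists k => [|l]; first by rewrite inE ks orbT.
  by rewrite inE => /orP[/eqP->|/kdvd//]; exists d.
exists i => [|l]; first exact: mem_head.
rewrite inE => /orP[/eqP->|/kdvd[f ->]]; first by exists 1; rewrite mul1r.
by exists (f * d); rewrite e mulrA.
Qed.

Lemma zero_divisorsM r z : Z z -> Z (r * z).
Proof. by move=> [x x0 zx]; exists x; rewrite // -mulrA zx mulr0. Qed.

(** One of y and z divides the other, and whatever kills the divisor kills the sum. *)
Lemma zero_divisorsD y z : Z y -> Z z -> Z (y + z).
Proof.
have [d [->|->]] := valuation_dvd y z.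
  by move=> _ [x x0 zx]; exists x => //; rewrite mulrDl -mulrA zx mulr0 addr0.
by move=> [x x0 yx] _; exists x => //; rewrite mulrDl -mulrA yx mulr0 addr0.
Qed.

(** Counterpart in R of the fact that a unit minus an element of the maximal ideal of the total
    quotient ring is a unit. *)
Lemma regular_sub s z : s \in regular -> Z z -> s - z \in regular.
Proof.
move=> sreg Zz; apply: contrapT => /negP/regularPn Zsz.
have /regularPn : Z s by rewrite -(subrK z s); exact: zero_divisorsD.
by rewrite sreg.
Qed.

Definition T_nilpotent : Prop :=
  forall a : nat -> R, (forall i, Z (a i)) -> exists k, \prod_(i < k) a i = 0.

(** In the total quotient ring this says that p is nilpotent and divides every element of Z; the
    regular factors replace denominators. The value p = 0 covers the case Z = 0. *)
Definition uniformizer p : Prop :=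
  (exists n, p ^+ n = 0) /\
  forall z, Z z -> exists2 s, s \in regular & exists r, s * z = r * p.

Lemma T_nilpotent_uniformizer : T_nilpotent -> exists p, uniformizer p.
Proof.
move=> TN; case: (pselect (forall z, Z z ->
    exists2 x, Z x & exists2 y, Z y & z = x * y)) => [fact|].
  exists 0; split; first by exists 1%N; rewrite expr1.
  move=> z Zz; exists 1; first exact: regular1.
  exists 0; rewrite mul0r mul1r.
  have /choice[f fP] (w : R) : exists xy : R * R,
      Z w -> [/\ Z xy.1, Z xy.2 & w = xy.1 * xy.2].
    case: (pselect (Z w)) => [Zw|nZw]; last by exists (0, 0).
    by have [x Zx [y Zy e]] := fact w Zw; exists (x, y).
  (* Splitting the second factor again and again writes z as a product of k first factors times
     [w k]; T-nilpotence applied to the first factors gives z = 0. *)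
  pose w k := iter k (fun v => (f v).2) z.
  have Zw k : Z (w k) by elim: k => // k IH; rewrite /w iterS; have [] := fP _ IH.
  have zE k : z = \prod_(i < k) (f (w i)).1 * w k.
    elim: k => [|k IH]; first by rewrite big_ord0 mul1r.
    rewrite big_ord_recr /= -mulrA {1}IH; congr (_ * _).
    by rewrite {1}/w; have [] := fP _ (Zw k).
  have [k k0] : exists k, \prod_(i < k) (f (w i)).1 = 0.
    apply: (TN (fun i => (f (w i)).1)) => i; by have [] := fP _ (Zw i).
  by rewrite (zE k) k0 mul0r.
move=> /existsNP[p /not_implyP[Zp pirr]]; exists p; split.
  have [k k0] := TN (fun=> p) (fun=> Zp).
  by exists k; rewrite prodr_const card_ord in k0.
move=> z Zz; have [d [->|e]] := valuation_dvd z p.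
  by exists 1; rewrite ?regular1 //; exists d; rewrite mul1r.
(* Here p = d * z. As p is not a product of two zero divisors, d is regular. *)
exists d; last by exists 1; rewrite mul1r.
apply: contrapT => /negP/regularPn Zd; apply: pirr.
by exists d => //; exists z.
Qed.

Lemma nilpotent_T_nilpotent : nilpotent_ideal Z -> T_nilpotent.
Proof.
move=> [n Zn] a Za; exists n.
suff : ideal_exp Z n (\prod_(i < n) a i) by rewrite Zn.
elim: n {Zn} a Za => // n IH a Za; rewrite big_ord_recl.
apply: sub_gen_smallest; exists (a 0%N) => //; exists (\prod_(i < n) a i.+1) => //.
exact: (IH (fun i => a i.+1)).
Qed.

(** Up to regular factors the k-th power of Z consists of multiples of [p ^+ k], so it vanishes as
    soon as [p ^+ k] does. *)
Lemma uniformizer_nilpotent p : uniformizer p -> nilpotent_ideal Z.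
Proof.
move=> [[n pn] pZ]; exists n.
have sub k : ideal_exp Z k `<=`
    [set y | exists2 s, s \in regular & exists r, s * y = r * p ^+ k].
  elim: k => [|k IH] /=.
    by move=> y _; exists 1; rewrite ?regular1 //; exists y; rewrite mulrC.
  apply: smallest_sub.
    apply/submoduleP; split=> [|a u v /= [s sr [r e]] [s' sr' [r' e']]].
      by exists 1; rewrite ?regular1 //; exists 0; rewrite mul0r mulr0.
    exists (s * s'); rewrite ?regularM //; exists (s' * a * r + s * r').
    have -> : s * s' * (a *: u + v : R^o) = s' * a * (s * u) + s * (s' * v).
      by rewrite /GRing.scale /=; ring.
    by rewrite e e'; ring.
  move=> _ /= [x /pZ[s sr [r e]]] [y /IH[s' sr' [r' e']] <-].
  exists (s * s'); rewrite ?regularM //; exists (r * r').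
  have -> : s * s' * (x * y) = (s * x) * (s' * y) by ring.
  by rewrite e e' exprS; ring.
apply/seteqP; split=> [y /sub[s sr [r]]|_ ->].
  by rewrite pn mulr0 => /regular_mul0; apply.
have : ideal (ideal_exp Z n).
  by case: n {pn sub} => [|n]; [apply/submoduleP|exact: generated_submodule].
by move=> /submoduleP[].
Qed.

Section Uniformizer.
Variable p : R.
Hypothesis unif_p : uniformizer p.

(** As long as the cofactor of [p ^+ k] is not regular it lies in Z and yields one more factor p;
    this stops at the latest when the power of p is 0. *)
Lemma uniformizer_pow y :
  exists s t k, [/\ s \in regular, t \in regular & s * y = t * p ^+ k].
Proof.
have [[n pn] pZ] := unif_p.
have [//|] : (exists s t k, [/\ s \in regular, t \in regular & s * y = t * p ^+ k])
   \/ exists2 s, s \in regular & exists r, s * y = r * p ^+ n.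
  elim: n {pn} => [|k [|[s sr [r e]]]]; [|by left|].
    by right; exists 1; rewrite ?regular1 //; exists y; rewrite mulrC.
  have [rr|/regularPn Zr] := boolP (r \in regular); first by left; exists s, r, k.
  have [t tr [q e']] := pZ r Zr; right; exists (t * s); first exact: regularM.
  by exists q; rewrite -mulrA e mulrA e' exprS mulrA.
(* Every cofactor was a zero divisor: y = 0, represented by [p ^+ n] = 0. *)
move=> [s sr [r]]; rewrite pn mulr0 => /regular_mul0 -> //.
by exists 1, 1, n; rewrite !regular1 pn !mulr0.
Qed.

(** An element of J with the least exponent in [uniformizer_pow] works. *)
Lemma principal_up_to_regular (J : set R) : J !=set0 ->
  exists2 r, J r & forall y, J y -> exists2 s, s \in regular & exists a, s * y = a * r.
Proof.
move=> [y0 Jy0].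
pose P k := `[< exists2 y, J y &
  exists s t, [/\ s \in regular, t \in regular & s * y = t * p ^+ k] >].
have exP : exists k, P k.
  have [s [t [k H]]] := uniformizer_pow y0.
  by exists k; apply/asboolP; exists y0 => //; exists s, t.
case: (ex_minnP exP) => k /asboolP[r Jr [s [t [sr tr e]]]] kmin.
exists r => // y Jy; have [s' [t' [k' [sr' tr' e']]]] := uniformizer_pow y.
have lek : (k <= k')%N by apply: kmin; apply/asboolP; exists y => //; exists s', t'.
exists (t * s'); first exact: regularM.
exists (t' * p ^+ (k' - k) * s).
by rewrite -[RHS]mulrA e -mulrA e' -(subnK lek) exprD addnK; ring.
Qed.

End Uniformizer.

(** * The descending chain condition in the total quotient ring *)

Section TotalQuotient.
Local Notation Q := (total_quotient_ring R).
Local Notation iota := (@Localization.of_base R regular : {rmorphism R -> Q}).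

Lemma ideal_mulr (A : comPzRingType) (I : set A) a x : ideal I -> I x -> I (a * x).
Proof. by move=> idI; exact: (submodule_scale (V := A^o)). Qed.

(** The ideals generated by the partial products c k stabilize, so s * c N = r * c N * a N with s
    regular. Then s - r * a N kills c N, and it is regular because a N is in Z. *)
Lemma artinian_T_nilpotent : artinian Q -> T_nilpotent.
Proof.
move=> art a Za; pose c k := \prod_(i < k) a i.
pose I k : set Q := [set q | exists r, q = r * iota (c k)].
have idI k : ideal (I k).
  apply/submoduleP; split=> [|r _ _ [u ->] [v ->]]; first by exists 0; rewrite mul0r.
  by exists (r * u + v); rewrite mulrDl -mulrA.
have [k|N stab] := art I idI.
  move=> _ [r ->]; exists (r * iota (a k)).
  by rewrite /c big_ord_recr /= rmorphM /=; ring.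
exists N; rewrite -/(c N).
have : I N (iota (c N)) by exists 1; rewrite mul1r.
rewrite -(stab N.+1 (leqnSn N)) => -[q e].
have [r [s [sr e']]] := Localization.of_base_div q.
have : iota (s * c N) = iota (r * c N.+1).
  by rewrite !rmorphM /= -e' e; ring.
move=> /Localization.of_base_eq[u ur /eqP].
rewrite -subr_eq0 -mulrBr => /eqP/(regular_mul0 ur).
have -> : s * c N - r * c N.+1 = (s - r * a N) * c N.
  by rewrite /c big_ord_recr /=; ring.
by apply: regular_mul0; apply: regular_sub => //; exact: zero_divisorsM.
Qed.

(** Every element of Q is associate to one of the powers of p with exponent at most n, so an ideal
    is determined by which of these finitely many powers it contains. *)
Lemma uniformizer_artinian p : uniformizer p -> artinian Q.
Proof.
move=> unif_p I idI Ile; have [[n pn] _] := unif_p.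
have leI m m' : (m <= m')%N -> I m' `<=` I m.
  move=> /subnK <-; elim: (_ - m)%N => // k IH x; rewrite addSn => /Ile; exact: IH.
have assoc q : exists k alpha beta, [/\ (k <= n)%N,
    iota (p ^+ k) = alpha * q & q = beta * iota (p ^+ k)].
  have [a [s' [sr' e']]] := Localization.of_base_div q.
  have [s [t [k [sr tr e]]]] := uniformizer_pow unif_p a.
  (* An exponent above n can be lowered to n, both powers being 0. *)
  wlog kn : k e / (k <= n)%N => [H|].
    have [/H|/ltnW nk] := leqP k n; first exact.
    by apply: (H n) => //; rewrite e -(subnK nk) exprD pn mulr0.
  have [t1 e1] := Localization.of_base_inv tr.
  have [s1 e2] := Localization.of_base_inv (regularM sr sr').
  have E : iota (s * s') * q = iota t * iota (p ^+ k).
    by rewrite rmorphM -mulrA /= e' -!rmorphM /= e.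
  exists k, (t1 * iota (s * s')), (s1 * iota t); split=> //.
    by rewrite -mulrA E mulrA [t1 * _]mulrC e1 mul1r.
  by rewrite -mulrA -E mulrA [s1 * _]mulrC e2 mul1r.
(* Each power of p either leaves the chain at some stage or never does; N lies beyond all these
   departures. *)
have [N stab] : exists N, forall k, (k < n.+1)%N -> forall m, (N <= m)%N ->
    I N (iota (p ^+ k)) -> I m (iota (p ^+ k)).
  elim: n.+1 => [|j [N IH]]; first by exists 0%N.
  have [[N' N'P]|noN] := pselect (exists N', ~ I N' (iota (p ^+ j))); last first.
    exists N => k; rewrite ltnS leq_eqVlt => /orP[/eqP->|/IH//] m _ _.
    by apply: contrapT => ?; apply: noN; exists m.
  exists (maxn N N') => k; rewrite ltnS leq_eqVlt => /orP[/eqP->|kj] m.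
    by move=> _ /(leI _ _ (leq_maxr _ _)).
  by rewrite geq_max => /andP[Nm _] /(leI _ _ (leq_maxl _ _)); exact: IH.
exists N => m Nm; apply/seteqP; split; first exact: leI.
move=> q INq; have [k [al [be [kn e1 e2]]]] := assoc q.
rewrite e2; apply: ideal_mulr => //; apply: stab => //.
by rewrite e1; exact: ideal_mulr.
Qed.

End TotalQuotient.
End ValuationRing.

(** * Computation rules for pure tensors *)

Section TensorTheory.
Variables (R : comNzRingType) (M N : lmodType R).

Lemma pure_tensorZl a (m : M) (n : N) :
  pure_tensor (a *: m) n = a *: pure_tensor m n.
Proof. exact: (scalable_linear ((pure_tensor_is_bilinear M N).1 n)). Qed.

Lemma pure_tensorDr (m : M) (n n' : N) :
  pure_tensor m (n + n') = pure_tensor m n + pure_tensor m n'.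
Proof.
have := (pure_tensor_is_bilinear M N).2 m 1 n n'.
by rewrite /= !scale1r => ->; congr (_ + _); exact: scale1r.
Qed.

Lemma pure_tensorZr a (m : M) (n : N) :
  pure_tensor m (a *: n) = a *: pure_tensor m n.
Proof. exact: (scalable_linear ((pure_tensor_is_bilinear M N).2 m)). Qed.

Lemma pure_tensor0r (m : M) : pure_tensor m (0 : N) = 0.
Proof. by have := pure_tensorZr 0 m 0; rewrite !scale0r. Qed.

End TensorTheory.

(** * Flat modules: annihilators, relations and finite projectivity *)

Section FlatOverValuationRing.
Variable R : comNzRingType.
Hypothesis val_R : valuation_ring R.

Section Torsion.
Variable r : R.

Let annr : set R^o := [set a | a * r = 0].

Let annrP : submodule annr.
Proof.
apply/submoduleP; split=> [|a u v]; rewrite /annr /= ?mul0r // => u0 v0.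
by rewrite mulrDl -[(a *: u) * r]mulrA u0 v0 mulr0 addr0.
Qed.

Let quo : lmodType R := QuotientModule.type annrP.

Let repr_proj (a : R^o) : repr (QuotientModule.proj annrP a) * r = a * r.
Proof.
apply/eqP; rewrite -subr_eq0 -mulrBl; apply/eqP.
suff : repr (QuotientModule.proj annrP a) - a \in annr by rewrite inE.
rewrite -(QuotientModule.proj_eq0 annrP) raddfB subr_eq0; apply/eqP.
exact: reprK.
Qed.

Let reprL a (q q' : quo) : repr (a *: q + q') * r = (a * repr q + repr q') * r.
Proof.
rewrite -[q in LHS]reprK -[q' in LHS]reprK.
have -> : a *: \pi_quo (repr q) + \pi_quo (repr q')
  = QuotientModule.proj annrP (a *: (repr q : R^o) + repr q').
  by rewrite linearP.
by rewrite repr_proj.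
Qed.

Let mulq (q : quo) : R^o := repr q * r.

Let mulq_linear : linear mulq.
Proof. by move=> a q q'; rewrite /mulq reprL mulrDl -mulrA. Qed.

HB.instance Definition _ := GRing.isLinear.Build R quo R^o _ mulq mulq_linear.

Let mulq_inj : injective mulq.
Proof.
move=> q q' e; rewrite -[q]reprK -[q']reprK; apply/eqP.
have -> : forall x, \pi_quo x = QuotientModule.proj annrP x by [].
rewrite -subr_eq0 -raddfB QuotientModule.proj_eq0 inE /annr /= mulrBl.
by apply/eqP; rewrite subr_eq0; apply/eqP.
Qed.

Section Module.
Variable M : lmodType R.

(** The submodule (ann r) M. Single products are closed under addition, since of two elements of ann
    r one divides the other. *)
Let annM : set M := [set y | exists c z, c * r = 0 /\ y = c *: z].

Let annMP : submodule annM.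
Proof.
apply/submoduleP; split=> [|a _ _ [c [z [c0 ->]]] [c' [z' [c0' ->]]]].
  by exists 0, 0; rewrite mul0r scaler0.
have [d [e|e]] := valuation_dvd val_R c c'.
  exists c', (a * d *: z + z'); split=> //.
  by rewrite scalerDr !scalerA e; congr (_ *: _ + _); ring.
exists c, (a *: z + d *: z'); split=> //.
by rewrite scalerDr !scalerA e; congr (_ *: _ + _ *: _); ring.
Qed.

(** The pairing behind the map from the tensor product of M and R / ann r to M / (ann r) M; it turns
    the vanishing of y tensor 1 into membership of y in (ann r) M. *)
Let evM (m : M) (q : quo) : QuotientModule.type annMP :=
  QuotientModule.proj annMP (repr q *: m).

Let evM_bilinear : bilinear_for *:%R *:%R evM.
Proof.
split=> [q a m m'|m a q q'] /=; rewrite /evM.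
  by rewrite -linearP scalerDr !scalerA mulrC.
rewrite -linearP; apply/eqP; rewrite -subr_eq0 -raddfB QuotientModule.proj_eq0.
rewrite scalerA -scalerDl -scalerBl inE; eexists _, m; split=> //.
by rewrite mulrBl reprL subrr.
Qed.

(* Tensor M with the injection R / ann r -> R induced by multiplication by r. *)
Lemma flat_annihilator (y : M) : flat M -> r *: y = 0 ->
  exists c z, c * r = 0 /\ y = c *: z.
Proof.
move=> flM ry0.
pose one : quo := QuotientModule.proj annrP (1 : R^o).
have t0 : pure_tensor y one = 0.
  apply: (flM quo R^o mulq mulq_inj).
  rewrite tensor_map_pure (linear_fun0 (tensor_map_is_linear _)).
  have e1 : mulq one = r *: (1 : R^o).
    by apply: etrans (repr_proj 1) _; rewrite /GRing.scale /= mul1r mulr1.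
  transitivity (pure_tensor y (r *: (1 : R^o))); first exact: congr1.
  rewrite pure_tensorZr -pure_tensorZl ry0.
  by have := pure_tensorZl 0 (0 : M) (1 : R^o); rewrite !scale0r.
have := tensor_lift_pure evM_bilinear y one.
rewrite t0 (linear_fun0 (tensor_lift_is_linear evM_bilinear)).
move=> /esym/eqP; rewrite /evM QuotientModule.proj_eq0 inE => -[c [z [c0 e]]].
have {e} : exists2 b : R, b * r = r & b *: y = c *: z.
  by exists (repr one) => //; apply: etrans (repr_proj 1) _; rewrite /= mul1r.
move=> [b br e]; have b1r : (b - 1) * r = 0 by rewrite mulrBl br mul1r subrr.
(* Now y = c *: z - (b - 1) *: y, where c and b - 1 both kill r; the one dividing the other is
   factored out. *)
have [d [E|E]] := valuation_dvd val_R c (b - 1).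
  exists (b - 1), (d *: z - y); split=> //.
  by rewrite scalerBr scalerA [_ * d]mulrC -E -e scalerBl scale1r opprB addrC subrK.
exists c, (z - d *: y); split=> //.
by rewrite scalerBr scalerA [_ * d]mulrC -E -e scalerBl scale1r opprB addrC subrK.
Qed.

End Module.
End Torsion.

Section Relations.
Variable M : lmodType R.
Hypothesis flatM : flat M.

(** The equational criterion of flatness for one relation. A coordinate [r 0 i0] divides the others,
    so it kills \sum_i d i *: y i, and [flat_annihilator] writes this sum as c *: z with c * r 0 i0
    = 0. *)
Lemma flat_relation n (r : 'rV[R]_n) (y : 'I_n -> M) :
  \sum_i r 0 i *: y i = 0 ->
  exists (D : 'M[R]_n) (z : 'I_n -> M),
    r *m D = 0 /\ forall i, y i = \sum_j D i j *: z j.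
Proof.
case: n r y => [|n] r y ry0; first by exists 0, y; split; [rewrite mulmx0|case].
have [|i0 _ dvd] := @valuation_dvd_family R val_R _ (r 0) (enum 'I_n.+1).
  by rewrite -size_eq0 size_enum_ord.
have /choice[d0 d0P] (i : 'I_n.+1) : exists d, r 0 i = d * r 0 i0.
  by apply: dvd; rewrite mem_enum.
pose d i := if i == i0 then 1 else d0 i.
have dP i : r 0 i = d i * r 0 i0 by rewrite /d; case: eqP => [->|_ //]; rewrite mul1r.
have di0 : d i0 = 1 by rewrite /d eqxx.
have [c [z [c0 e]]] : exists c z, c * r 0 i0 = 0 /\ \sum_i d i *: y i = c *: z.
  apply: flat_annihilator => //; rewrite -[RHS]ry0 scaler_sumr.
  by apply: eq_bigr => i _; rewrite scalerA mulrC -dP.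
(* The new family has z in place of [y i0]. Since d i0 = 1, row i0 can solve for [y i0] as c *: z
   minus the other terms d j *: y j; the remaining rows are those of the identity. *)
exists (\matrix_(i, j) (if i == i0 then if j == i0 then c else - d j
                        else (i == j)%:R)), (fun j => if j == i0 then z else y j).
split.
  apply/rowP => j; rewrite !mxE (bigD1 i0) //= mxE eqxx.
  case: (eqVneq j i0) => [->|ji0].
    rewrite mulrC c0 add0r big1 // => i ii0.
    by rewrite mxE (negPf ii0) mulr0.
  rewrite (bigD1 j) //= mxE (negPf ji0) eqxx mulr1 big1 => [|i /andP[ii0 ij]].
    by rewrite (dP j); ring.
  by rewrite mxE (negPf ii0) (negPf ij) mulr0.
move=> i; case: (eqVneq i i0) => [->|ii0].
  rewrite (bigD1 i0) //= mxE !eqxx -e (bigD1 i0) //= di0 scale1r -addrA -big_split /=.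
  rewrite big1 ?addr0 // => j ji0.
  by rewrite mxE eqxx (negPf ji0) scaleNr subrr.
rewrite (bigD1 i) //= mxE (negPf ii0) eqxx scale1r big1 ?addr0 // => j ji.
by rewrite mxE (negPf ii0) eq_sym (negPf ji) scale0r.
Qed.

Variable p : R.
Hypothesis unif_p : uniformizer p.

(** As C kills every relation between the x i, sending the combination with coefficients k to
    [k *m C] is well defined on their span; this gives the map to a free module. *)
Lemma flat_relations m (x : 'I_m -> M) :
  exists n (C : 'M[R]_(m, n)) (y : 'I_n -> M),
    (forall i, x i = \sum_j C i j *: y j) /\
    forall k : 'rV[R]_m, \sum_i k 0 i *: x i = 0 -> k *m C = 0.
Proof.
suff /(_ m)[n [C [y [xE CK]]]] : forall l, exists n (C : 'M[R]_(m, n)) (y : 'I_n -> M),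
    (forall i, x i = \sum_j C i j *: y j) /\
    forall k : 'rV[R]_m, \sum_i k 0 i *: x i = 0 ->
      (forall i : 'I_m, (l <= i)%N -> k 0 i = 0) -> k *m C = 0.
  exists n, C, y; split=> // k k0; apply: CK => // i.
  by rewrite leqNgt ltn_ord.
(* The values at coordinate [l] of the relations supported in [0, l] have, up to
   regular factors, a common generator attained by one relation [r]; making
   [r] vanish takes care of all of them. *)
elim=> [|l [n [C [y [xE CK]]]]].
  exists m, 1%:M, x; split=> [i|k _ k0].
    rewrite (bigD1 i) //= mxE eqxx scale1r big1 ?addr0 // => j ji.
    by rewrite mxE eq_sym (negPf ji) scale0r.
  by rewrite mulmx1; apply/rowP => i; rewrite k0 // mxE.
have [ml|lm] := leqP m l.
  exists n, C, y; split=> // k k0 _; apply: CK => // i /(leq_trans ml).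
  by rewrite leqNgt ltn_ord.
pose il := Ordinal lm.
pose K : set 'rV[R]_m := [set k | \sum_i k 0 i *: x i = 0 /\
  forall i : 'I_m, (l < i)%N -> k 0 i = 0].
have K0 : K 0.
  by split=> [|i _]; rewrite ?mxE // big1 // => i _; rewrite mxE scale0r.
have [|_ [r [rx0 rsup] <-] rP] :=
  @principal_up_to_regular R p unif_p [set k 0 il | k in K].
  by exists ((0 : 'rV[R]_m) 0 il), 0.
have : \sum_j (r *m C) 0 j *: y j = 0.
  rewrite -[RHS]rx0; under [RHS]eq_bigr do rewrite xE scaler_sumr.
  rewrite exchange_big /=; apply: eq_bigr => j _ /=.
  by rewrite mxE scaler_suml; apply: eq_bigr => i _; rewrite scalerA.
move=> /flat_relation[D [z [rCD yE]]].
exists n, (C *m D), z; split=> [i|k kx0 ksup].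
  rewrite xE; under eq_bigr do rewrite yE scaler_sumr.
  rewrite exchange_big; apply: eq_bigr => j _.
  by rewrite mxE scaler_suml; apply: eq_bigr => i' _; rewrite scalerA.
have [s sreg [a e]] : exists2 s, s \in @nonzero_divisor R &
    exists a, s * k 0 il = a * r 0 il by apply: rP; exists k.
(* This relation vanishes at coordinate l, so the induction hypothesis gives s *: (k *m C) = a *: (r
   *m C), which D kills; the regular s then cancels. *)
have : (s *: k - a *: r) *m C = 0.
  apply: CK => [|i].
    under eq_bigr do rewrite !mxE scalerBl -!scalerA.
    by rewrite sumrB -!scaler_sumr kx0 rx0 !scaler0 subrr.
  rewrite leq_eqVlt => /orP[/eqP li|li]; last first.
    by rewrite !mxE ksup // rsup // !mulr0 subrr.
  have -> : i = il by apply: val_inj.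
  by rewrite !mxE e subrr.
rewrite mulmxBl -!scalemxAl => /eqP; rewrite subr_eq0 => /eqP e'.
have : s *: (k *m (C *m D)) = 0.
  by rewrite mulmxA scalemxAl e' -scalemxAl rCD scaler0.
move=> /rowP sk0; apply/rowP => j.
by have := sk0 j; rewrite !mxE => /(regular_mul0 sreg).
Qed.

Lemma uniformizer_finitely_projective : finitely_projective M.
Proof.
move=> S N [G /finite_seqP[s Gs] genN].
pose m := size s; pose g (i : 'I_m) : N := tnth (in_tuple s) i.
have span w : exists a : 'rV[R]_m, w = \sum_i a 0 i *: g i.
  suff sub : generated G `<=` [set w | exists a : 'rV[R]_m, w = \sum_i a 0 i *: g i].
    by apply: sub; rewrite genN.
  apply: smallest_sub.
    apply/submoduleP; split=> [|c _ _ [a ->] [b ->]].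
      by exists 0; rewrite big1 // => i _; rewrite mxE scale0r.
    exists (c *: a + b); rewrite scaler_sumr -big_split /=.
    by apply: eq_bigr => i _; rewrite !mxE scalerDl scalerA.
  move=> v; rewrite Gs /= => /(tnthP (in_tuple s))[i ->].
  exists (delta_mx 0 i); rewrite (bigD1 i) //= mxE !eqxx scale1r big1 ?addr0 //.
  by move=> j ji; rewrite mxE (negPf ji) andbF scale0r.
have /choice[a aP] := span.
have [n [C [y [xE CK]]]] := flat_relations (fun i => \val (g i)).
have valE (b : 'rV[R]_m) : \val (\sum_i b 0 i *: g i) = \sum_i b 0 i *: \val (g i).
  rewrite raddf_sum; apply: eq_bigr => i _.
  exact: (linearZ_LR (\val : {linear N -> M})).
(* The chosen coefficients [a w] need not be linear in w, but their defects of linearity are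
   relations, which C kills. *)
pose u (w : N) : {freeg 'I_n / R} := \sum_j (a w *m C) 0 j *: << j >>.
have u_lin : linear u.
  move=> c w w'; rewrite /u scaler_sumr -big_split /=; apply: eq_bigr => j _.
  rewrite scalerA -scalerDl; congr (_ *: _).
  have : (a (c *: w + w') - (c *: a w + a w')) *m C = 0.
    apply: CK.
    have -> : \sum_i (a (c *: w + w') - (c *: a w + a w')) 0 i *: \val (g i) =
        \val (\sum_i (a (c *: w + w') - (c *: a w + a w')) 0 i *: g i).
      by rewrite valE.
    have -> : \sum_i (a (c *: w + w') - (c *: a w + a w')) 0 i *: g i =
        \sum_i a (c *: w + w') 0 i *: g i -
        (c *: (\sum_i a w 0 i *: g i) + \sum_i a w' 0 i *: g i).
      rewrite scaler_sumr -big_split -sumrB /=; apply: eq_bigr => i _.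
      by rewrite !mxE scalerBl scalerDl scalerA.
    rewrite -!aP.
    by rewrite subrr raddf0.
  rewrite mulmxBl => /eqP; rewrite subr_eq0 => /eqP ->.
  by rewrite mulmxDl -scalemxAl !mxE.
pose v (D : {freeg 'I_n / R}) : M := \sum_j coeff j D *: y j.
have v_lin : linear v.
  move=> c D D'; rewrite /v scaler_sumr -big_split /=; apply: eq_bigr => j _.
  by rewrite coeffD coeffZ scalerDl scalerA.
pose ul := GRing.isLinear.Build R N {freeg 'I_n / R} _ u u_lin.
pose vl := GRing.isLinear.Build R {freeg 'I_n / R} M _ v v_lin.
pose U : {linear N -> {freeg 'I_n / R}} := HB.pack u ul.
pose V : {linear {freeg 'I_n / R} -> M} := HB.pack v vl.
exists {freeg 'I_n / R}, U, V; split.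
  exists 'I_n, (idfun : {linear {freeg 'I_n / R} -> {freeg 'I_n / R}}).
  by exists idfun.
move=> w; rewrite /= /u /v {1}(aP w) valE.
under eq_bigr do rewrite xE scaler_sumr.
rewrite exchange_big; apply: eq_bigr => j _.
have -> : coeff j (\sum_j0 (a w *m C) 0 j0 *: (<< j0 >> : {freeg 'I_n / R})) =
    (a w *m C) 0 j.
  rewrite raddf_sum (bigD1 j) //= coeffZ coeffU eqxx !mulr1 big1 ?addr0 // => k kj.
  by rewrite coeffZ coeffU (negPf kj) !mulr0.
by rewrite mxE scaler_suml; apply: eq_bigr => i _; rewrite scalerA.
Qed.

End Relations.
End FlatOverValuationRing.

(** * Singly projective modules and cyclic submodules *)

Lemma finitely_singly_projective (R : comNzRingType) (M : lmodType R) :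
  finitely_projective M -> singly_projective M.
Proof.
by move=> fpM S N [x genx]; apply: fpM; exists [set x].
Qed.

Section CyclicSubmodule.
Variables (R : comNzRingType) (V : lmodType R) (x : V).

Definition cyclic_pred : {pred V} := [pred v | `[< exists r, v = r *: x >]].

Lemma cyclic_pred_submod : GRing.submod_closed cyclic_pred.
Proof.
split=> [|a u v]; first by apply/asboolP; exists 0; rewrite scale0r.
move=> /asboolP[r ->] /asboolP[s ->]; apply/asboolP; exists (a * r + s).
by rewrite scalerDl scalerA.
Qed.

HB.instance Definition _ := GRing.isSubmodClosed.Build R V cyclic_pred
  (GRing.submod_closed_semi cyclic_pred_submod).

Definition cyclic_submodule : Type := {v : V | v \in cyclic_pred}.
HB.instance Definition _ := SubChoice.on cyclic_submodule.
HB.instance Definition _ := [SubChoice_isSubLmodule of cyclic_submodule by <:].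

Lemma mem_cyclic_pred : x \in cyclic_pred.
Proof. by apply/asboolP; exists 1; rewrite scale1r. Qed.

Definition cyclic_generator : cyclic_submodule := Sub x mem_cyclic_pred.

Lemma cyclic_submodule_cyclic : cyclic_module cyclic_submodule.
Proof.
exists cyclic_generator; apply/seteqP; split=> // w _.
have /asboolP[r e] := valP w.
have -> : w = r *: cyclic_generator.
  by apply: val_inj; rewrite e linearZ_LR.
apply: (submodule_scale _ (generated_submodule _)).
exact: (@sub_generated _ _ [set cyclic_generator]).
Qed.

End CyclicSubmodule.

(* The coordinates of an element of a free module are all multiples of one of
   them, so a single coefficient suffices. *)
Lemma singly_projective_coefficient (R : comNzRingType) (M : lmodType R) (x : M) :
  valuation_ring R -> singly_projective M ->
  exists c m, x = c *: m /\ forall r, r *: x = 0 -> r * c = 0.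
Proof.
move=> val_R /(_ _ _ (cyclic_submodule_cyclic x))[F [u [v [[I [h [h' hK h'K]]] uv]]]].
pose D := h' (u (cyclic_generator x)).
have xE : x = \sum_(i <- dom D) coeff i D *: v (h << i >>).
  have -> : x = v (h D) by rewrite /D h'K; exact: (uv (cyclic_generator x)).
  rewrite -{1}(freeg_sumE D) !raddf_sum; apply: eq_bigr => i _.
  rewrite -!linearZ_LR; congr (v (h _)).
  by apply/eqP/freeg_eqP => j; rewrite coeffZ !coeffU mul1r.
have annD r i : r *: x = 0 -> r * coeff i D = 0.
  move=> rx0; rewrite -coeffZ.
  have -> : r *: D = 0; last exact: coeff0.
  apply: (can_inj hK); rewrite linearZ_LR /D h'K raddf0 -linearZ_LR.
  have -> : r *: cyclic_generator x = 0; last exact: raddf0.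
  by apply: val_inj; rewrite linearZ_LR raddf0.
have [dom0|/(valuation_dvd_family val_R (fun i => coeff i D))[i _ dvd]] :=
  eqVneq (dom D) [::].
  exists 0, 0; split=> [|r _]; last exact: mulr0.
  by rewrite xE dom0 big_nil scaler0.
have /choice[d dP] j : exists d, j \in dom D -> coeff j D = d * coeff i D.
  have [/dvd[d e]|_] := boolP (j \in dom D); last by exists 0.
  by exists d.
(* c is the coordinate dividing all others, and m collects the quotients. *)
exists (coeff i D), (\sum_(j <- dom D) d j *: v (h << j >>)); split=> [|r /annD//].
rewrite {1}xE scaler_sumr big_seq [RHS]big_seq; apply: eq_bigr => j /dP ->.
by rewrite scalerA mulrC.
Qed.

(** * The telescope of a sequence and its flatness *)

Section Telescope.
Variables (R : comNzRingType) (a : nat -> R).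

(** For i <= n, the multiplier of the transition map from the i-th copy of R to the n-th. *)
Definition tail_prod i n : R := \prod_(i <= j < n) a j.

Lemma tail_prodS i n : (i <= n)%N -> tail_prod i n.+1 = tail_prod i n * a n.
Proof. exact: big_nat_recr. Qed.

Lemma tail_prod_cat i n m : (i <= n <= m)%N ->
  tail_prod i m = tail_prod i n * tail_prod n m.
Proof. by case/andP=> ? ?; exact: big_cat_nat. Qed.

(** A polynomial encodes a finite family whose i-th coefficient lives in the i-th copy of R. Terms
    of degree at least n are dropped, so the value is compatible with the transition maps only from
    n = size q on. *)
Definition telescope_eval n (q : {poly R}) : R := \sum_(i < n) q`_i * tail_prod i n.

Lemma telescope_eval_is_linear n : linear_for *%R (telescope_eval n).
Proof.
move=> c q q'; rewrite /telescope_eval mulr_sumr -big_split /=.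
by apply: eq_bigr => i _; rewrite coefD coefZ; ring.
Qed.

HB.instance Definition _ n :=
  GRing.isLinear.Build R {poly R} R *%R (telescope_eval n) (telescope_eval_is_linear n).

Lemma telescope_evalXn i n : (i < n)%N -> telescope_eval n 'X^i = tail_prod i n.
Proof.
move=> lt_in; rewrite /telescope_eval (bigD1 (Ordinal lt_in)) //= coefXn eqxx mul1r.
rewrite big1 ?addr0 // => j ji; rewrite coefXn.
by rewrite (_ : (_ == _ :> nat) = false) ?mul0r //; exact: negbTE.
Qed.

Lemma telescope_eval_cat (q : {poly R}) n m : (size q <= n)%N -> (n <= m)%N ->
  telescope_eval m q = telescope_eval n q * tail_prod n m.
Proof.
move=> qn nm; rewrite /telescope_eval mulr_suml.
rewrite -(big_mkord predT (fun i => q`_i * tail_prod i m)) (big_cat_nat (leq0n n) nm) /=.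
rewrite big_mkord [X in _ + X]big1_seq ?addr0 => [|i].
  apply: eq_bigr => i _; rewrite (@tail_prod_cat i n m) ?mulrA //.
  by rewrite nm ltnW.
rewrite mem_index_iota => /andP[_ /andP[ni _]].
by rewrite nth_default ?mul0r // (leq_trans qn).
Qed.

Definition telescope_relation : set {poly R} :=
  [set q | exists N, forall n, (N <= n)%N -> telescope_eval n q = 0].

Lemma telescope_relation_submodule : submodule telescope_relation.
Proof.
apply/submoduleP; split=> [|c q q' [N NP] [N' N'P]].
  by exists 0%N => n _; rewrite raddf0.
exists (maxn N N') => n; rewrite geq_max => /andP[Nn N'n].
by rewrite linearP /= NP // N'P // mulr0 addr0.
Qed.

(* The direct limit of R --a_0--> R --a_1--> ...; the class of 'X^i is the image
   of 1 from the i-th copy of R, and [telescope_eval n] computes in the n-th. *)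
Definition telescope : lmodType R := QuotientModule.type telescope_relation_submodule.

Definition telescope_class : {linear {poly R} -> telescope} :=
  QuotientModule.proj telescope_relation_submodule.

Lemma telescope_class_eq0 q : telescope_class q = 0 <-> telescope_relation q.
Proof.
have := QuotientModule.proj_eq0 telescope_relation_submodule q.
by split=> [/eqP|rel]; [rewrite H inE|apply/eqP; rewrite H inE].
Qed.

Lemma telescope_class_eq q q' : telescope_class q = telescope_class q' <->
  telescope_relation (q - q').
Proof.
rewrite -telescope_class_eq0 linearB; split=> [->|/eqP]; first by rewrite subrr.
by rewrite subr_eq0 => /eqP.
Qed.

Lemma telescope_class_top (q : {poly R}) n : (size q <= n)%N ->
  telescope_class q = telescope_eval n q *: telescope_class 'X^n.
Proof.
move=> qn; rewrite -linearZ_LR; apply/telescope_class_eq; exists n.+1 => m nm.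
rewrite linearB linearZ_LR /= telescope_evalXn //.
by rewrite (telescope_eval_cat qn (ltnW nm)) subrr.
Qed.

Lemma telescope_class_surj (x : telescope) : exists q, x = telescope_class q.
Proof. by exists (repr x); exact: (esym (reprK x)). Qed.

Section Flatness.
Variable B : lmodType R.

(* A tensor over the telescope is detected by germs at infinity of sequences in
   B, which stand in for the telescope of B. *)
Let null : set (nat -> B) := [set s | exists N, forall n, (N <= n)%N -> s n = 0].

Let nullP : submodule null.
Proof.
apply/submoduleP; split=> [|c s s' [N NP] [N' N'P]]; first by exists 0%N.
exists (maxn N N') => n; rewrite geq_max => /andP[Nn N'n].
have -> : (c *: s + s') n = c *: s n + s' n by [].
by rewrite NP // N'P // scaler0 addr0.
Qed.

Let germ (x : telescope) (b : B) : QuotientModule.type nullP :=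
  QuotientModule.proj nullP (fun n => telescope_eval n (repr x) *: b).

Let germ_class q b : germ (telescope_class q) b =
  QuotientModule.proj nullP (fun n => telescope_eval n q *: b).
Proof.
apply/eqP; rewrite -subr_eq0 -raddfB QuotientModule.proj_eq0 inE.
have /telescope_class_eq[N NP] :
    telescope_class (repr (telescope_class q)) = telescope_class q.
  exact: reprK.
exists N => n Nn; have := NP n Nn; rewrite raddfB => e.
by rewrite -[LHS]/(_ - _) -scalerBl e scale0r.
Qed.

Let germ_bilinear : bilinear_for *:%R *:%R germ.
Proof.
split=> [b c x x'|x c b b'] /=.
  have [[q ->] [q' ->]] := (telescope_class_surj x, telescope_class_surj x').
  rewrite -linearP !germ_class -linearP; congr QuotientModule.proj; apply/funext => n.
  by rewrite linearP /= scalerDl -scalerA.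
rewrite /germ -linearP; congr QuotientModule.proj; apply/funext => n.
by rewrite scalerDr !scalerA mulrC -scalerA.
Qed.

(** The map induced by [germ] sends this tensor to the germ of the sequence with terms
    [tail_prod n m *: b] for m > n. *)
Lemma telescope_tensor_eq0 n (b : B) : pure_tensor (telescope_class 'X^n) b = 0 ->
  exists2 m, (n <= m)%N & tail_prod n m *: b = 0.
Proof.
move=> t0; have := tensor_lift_pure germ_bilinear (telescope_class 'X^n) b.
rewrite t0 (linear_fun0 (tensor_lift_is_linear germ_bilinear)).
rewrite germ_class => /esym/eqP; rewrite QuotientModule.proj_eq0 inE => -[N NP].
exists (maxn N n.+1); first by rewrite (leq_trans (leqnSn n)) ?leq_maxr.
by rewrite -telescope_evalXn ?leq_maxr // NP ?leq_maxl.
Qed.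

Lemma telescope_tensor_shift n m (b : B) : (n <= m)%N ->
  pure_tensor (telescope_class 'X^n) b =
  pure_tensor (telescope_class 'X^m) (tail_prod n m *: b).
Proof.
move=> nm; rewrite pure_tensorZr -pure_tensorZl; congr pure_tensor.
rewrite -linearZ_LR; apply/telescope_class_eq; exists m.+1 => k mk.
rewrite linearB linearZ_LR /= !telescope_evalXn // ?(leq_ltn_trans nm) //.
by rewrite (@tail_prod_cat n m k) ?subrr // nm ltnW.
Qed.

(** The telescope is the increasing union of the submodules spanned by the classes of 'X^n, so the
    terms of a tensor can all be moved to a common stage. *)
Lemma telescope_tensor_pure (t : tensor telescope B) :
  exists n b, t = pure_tensor (telescope_class 'X^n) b.
Proof.
have -> : t = QuotientModule.proj
    (generated_submodule (@tensor_relator R telescope B)) (repr t).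
  by rewrite /QuotientModule.proj reprK.
rewrite -(freeg_sumE (repr t)) linear_sum /=.
elim: (dom _) => [|[x b] s [n [b' IH]]].
  exists 0%N, 0; rewrite big_nil.
  by rewrite pure_tensor0r.
rewrite big_cons IH; set k := coeff _ _.
have -> : QuotientModule.proj (generated_submodule (@tensor_relator R telescope B))
    << k *g (x, b) >> = k *: pure_tensor x b.
  rewrite -linearZ_LR; congr QuotientModule.proj.
  by apply/eqP/freeg_eqP => z; rewrite coeffZ !coeffU mul1r.
have [q ->] := telescope_class_surj x.
rewrite (telescope_class_top (leq_maxl (size q) n)).
rewrite (telescope_tensor_shift _ (leq_maxr (size q) n)).
rewrite pure_tensorZl -!pure_tensorZr -pure_tensorDr.
by eexists; eexists.
Qed.

End Flatness.

(** If 'X^n tensor f b vanishes, some [tail_prod n m] kills f b, hence b by injectivity; moving to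
    stage m shows that 'X^n tensor b is 0. *)
Lemma telescope_flat : flat telescope.
Proof.
move=> A B f f_inj.
have map_lin := tensor_map_is_linear (M := telescope) f.
move=> t t' e; apply/eqP; rewrite -subr_eq0; apply/eqP.
have : tensor_map telescope f (t - t') = 0.
  by have := map_lin (-1) t' t; rewrite !scaleN1r e addNr [- t' + t]addrC.
have [n [b ->]] := telescope_tensor_pure (t - t').
rewrite tensor_map_pure => /telescope_tensor_eq0[m nm].
rewrite -linearZ_LR -(raddf0 f) => /f_inj fb0.
by rewrite (telescope_tensor_shift b nm) fb0 pure_tensor0r.
Qed.

End Telescope.

(** * From single projectivity to T-nilpotence, and the cycle of implications *)

Lemma singly_projective_T_nilpotent (R : comNzRingType) : valuation_ring R ->
  (forall M : lmodType R, flat M -> singly_projective M) -> T_nilpotent R.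
Proof.
move=> val_R sp a Za.
have [c [m [xE ann]]] := singly_projective_coefficient
  (telescope_class a 'X^0) val_R (sp _ (@telescope_flat R a)).
have [q mE] := telescope_class_surj m.
(* Comparing x = c *: m in a far copy of R shows that c divides a partial product; [N.+1] keeps the
   stage positive, so that 'X^0 is not truncated. *)
have [N [d cd]] : exists N d, tail_prod a 0 N = d * c.
  move: xE; rewrite mE -linearZ_LR => /telescope_class_eq[N NP].
  exists N.+1, (telescope_eval a N.+1 q); have := NP N.+1 (leqnSn N).
  rewrite linearB linearZ_LR /= telescope_evalXn // => /eqP.
  by rewrite subr_eq0 => /eqP->; rewrite mulrC.
exists N; rewrite -(big_mkord predT a) -/(tail_prod a 0 N).
(* What kills the next product kills x, hence c, hence the multiple d * c. *)
have annN r : r * tail_prod a 0 N.+1 = 0 -> r * tail_prod a 0 N = 0.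
  move=> r0; rewrite cd mulrCA ann ?mulr0 //.
  rewrite -linearZ_LR; apply/telescope_class_eq0; exists N.+1 => n Nn.
  rewrite linearZ_LR /= telescope_evalXn ?(leq_trans _ Nn) //.
  by rewrite (@tail_prod_cat _ a 0 N.+1 n) // mulrA r0 mul0r.
(* If y = e * w, then e kills w * a N, so [annN] gives y = 0, which is absurd. Hence w is a multiple
   of y, so w * a N = 0 and [annN] at 1 gives w = 0. *)
have [y y0 ay] := Za N.
set w := tail_prod a 0 N in annN *; rewrite tail_prodS // -/w in annN.
have [e [yE|wE]] := valuation_dvd val_R y w.
  case/eqP: y0; rewrite yE; apply: annN.
  by rewrite mulrA -yE mulrC.
have := annN 1; rewrite !mul1r; apply.
by rewrite wE -mulrA [y * _]mulrC ay mulr0.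
Qed.

Theorem theorem4p12 (R : comNzRingType) (val_R : valuation_ring R) :
  [<-> nilpotent_ideal (zero_divisors R);
       artinian (total_quotient_ring R);
       forall M : lmodType R, flat M -> finitely_projective M;
       forall M : lmodType R, flat M -> singly_projective M].
Proof.
have unif := T_nilpotent_uniformizer val_R.
tfae=> [/nilpotent_T_nilpotent/unif[p]|||].
- exact: uniformizer_artinian.
- move=> /(artinian_T_nilpotent val_R)/unif[p pP] M flatM.
  exact: (uniformizer_finitely_projective val_R flatM pP).
- by move=> fp M /fp; exact: finitely_singly_projective.
- by move=> /(singly_projective_T_nilpotent val_R)/unif[p]; exact: uniformizer_nilpotent.
Qed.
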